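(* Let $k\ge 3$ be an odd integer and let $n\ge 2$ be an integer. Let $N_{\rm d}=k^n$, and let $p_{\rm d}(\epsilon)$ and $p_n(\epsilon)$ be the probabilities of reaching the correct outcome in, respectively, the direct majority-voting system with $N_{\rm d}$ voters and the hierarchical majority-voting system with $n$ layers and group size $k$ (hence with the same number $N_{\rm d}=k^n$ of voters in the electorate), where every voter votes for the correct outcome independently with probability $\epsilon$. Then: (i) $p_{\rm d}(\epsilon)=p_n(\epsilon)$ for $\epsilon\in\{0,\tfrac12,1\}$; (ii) $p_{\rm d}(\epsilon)<p_n(\epsilon)$ for all $\epsilon\in(0,\tfrac12)$; (iii) $p_{\rm d}(\epsilon)>p_n(\epsilon)$ for all $\epsilon\in(\tfrac12,1)$.
   Context: Hierarchical system: a rooted tree in which every non-leaf node has exactly $k$ children ($k$ odd) and all $k^n$ leaves are at depth $n$. The leaves (the electorate) are independently in state $1$ (correct) with probability $\epsilon$ and in state $0$ otherwise. Every non-leaf node takes the state of the majority of its $k$ children. $p_n(\epsilon)$ is the probability that the root is in state $1$. Equivalently, $p_0(\epsilon)=\epsilon$ and, for $1\le i\le n$, $$p_i(\epsilon)=\sum_{j=\lceil k/2\rceil}^{k}\binom{k}{j}\,p_{i-1}(\epsilon)^j\,(1-p_{i-1}(\epsilon))^{k-j}.$$ Direct system: a single majority vote among $N_{\rm d}=k^n$ independent voters, so $$p_{\rm d}(\epsilon)=\sum_{j=\lceil N_{\rm d}/2\rceil}^{N_{\rm d}}\binom{N_{\rm d}}{j}\,\epsilon^j(1-\epsilon)^{N_{\rm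 d}-j}.$$ The convention $0^0=1$ is used. *)

(* Defs.v *)
From HB Require Import structures.
From mathcomp Require Import all_boot all_order all_algebra.
Set Implicit Arguments.
Unset Strict Implicit.
Unset Printing Implicit Defensive.
Import Order.TTheory GRing.Theory Num.Theory.
Local Open Scope ring_scope.

(* Strict majority; no ties occur when #|T| is odd. *)
Definition majority (T : finType) (x : T -> bool) : bool :=
  (#|T| < 2 * #|[pred t | x t]|)%N.

(* Probability of [E] under the product measure on {0,1}^T whose marginals are
   all Bernoulli(e). *)
Definition iid_prob (R : realFieldType) (T : finType) (e : R)
    (E : pred {ffun T -> bool}) : R :=
  \sum_(x : {ffun T -> bool} | E x) \prod_(t : T) (if x t then e else 1 - e).

Definition p_direct (R : realFieldType) (N : nat) (e : R) : R :=
  iid_prob e (fun x : {ffun 'I_N -> bool} => majority x).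

(* A leaf of the complete k-ary tree of depth n is encoded by the path
   [n.-tuple 'I_k] leading to it from the root; the leaves below the i-th child
   of the root are those whose path starts with i. *)
Fixpoint root_state (k n : nat) : (n.-tuple 'I_k -> bool) -> bool :=
  match n with
  | 0 => fun x => x [tuple]
  | m.+1 => fun x =>
      majority (fun i : 'I_k =>
        root_state (fun t : m.-tuple 'I_k => x [tuple of i :: t]))
  end.

Definition p_hier (R : realFieldType) (k n : nat) (e : R) : R :=
  iid_prob e (fun x : {ffun n.-tuple 'I_k -> bool} => root_state x).

Lemma iid_prob_weight (R : realFieldType) (T : finType) (e : R)
    (x : {ffun T -> bool}) :
  \prod_(t : T) (if x t then e else 1 - e) =
  e ^+ #|[pred t | x t]| * (1 - e) ^+ (#|T| - #|[pred t | x t]|).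
Proof.
rewrite (bigID (fun t => x t)) /=; congr (_ * _).
  rewrite (eq_bigr (fun=> e)) ?prodr_const // => t ->; by [].
rewrite (eq_bigr (fun=> 1 - e)) => [|t /negbTE -> //].
rewrite prodr_const; congr (_ ^+ _).
by rewrite -(cardC [pred t | x t]) addKn; apply: eq_card.
Qed.

Lemma card_ffun_bool (T : finType) (j : nat) :
  #|[pred x : {ffun T -> bool} | #|[pred t | x t]| == j]| = 'C(#|T|, j).
Proof.
rewrite -(card_draws T j) -(card_imset _ (f := fun A : {set T} => [ffun t => t \in A])).
  apply: eq_card => x; rewrite !inE; apply/idP/imsetP.
    move=> /eqP hx; exists [set t | x t]; last by apply/ffunP=> t; rewrite ffunE inE.
    by rewrite inE -hx cardsE.
  case=> A; rewrite inE => /eqP <- ->; apply/eqP/eq_card => t.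
  by rewrite !inE ffunE.
move=> A B /ffunP h; apply/setP => t; by have := h t; rewrite !ffunE.
Qed.

Lemma p_directE (R : realFieldType) (N : nat) (e : R) : odd N ->
  p_direct N e =
  \sum_(uphalf N <= j < N.+1) ('C(N, j))%:R * e ^+ j * (1 - e) ^+ (N - j).
Proof.
move=> oN; rewrite /p_direct /iid_prob.
pose c (x : {ffun 'I_N -> bool}) : 'I_N.+1 := inord #|[pred t | x t]|.
have cE x : c x = #|[pred t | x t]| :> nat.
  by rewrite inordK // ltnS -[X in (_ <= X)%N]card_ord max_card.
rewrite (partition_big c (fun j => uphalf N <= j)%N) /=; last first.
  move=> x; rewrite /majority card_ord cE mul2n => h.
  by rewrite leq_uphalf_double ltnW.
rewrite big_geq_mkord; apply: eq_bigr => j hj.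
rewrite (eq_bigr (fun=> e ^+ j * (1 - e) ^+ (N - j))); last first.
  by move=> x /andP[_ /eqP <-]; rewrite iid_prob_weight cE card_ord.
rewrite sumr_const -mulrA mulr_natl; congr (_ *+ _).
have := card_ffun_bool 'I_N j; rewrite card_ord => <-; apply: eq_card => x.
rewrite !inE unfold_in /= -val_eqE /= cE /majority card_ord andbC.
case: eqP => //= ->; move: hj; rewrite leq_uphalf_double mul2n leq_eqVlt.
by case: eqP => // h; have := odd_double j; rewrite -[in LHS]h oN.
Qed.

Lemma p_hier0 (R : realFieldType) (k : nat) (e : R) : p_hier k 0 e = e.
Proof.
rewrite /p_hier /iid_prob (big_pred1 [ffun=> true]) => [|x].
  rewrite (eq_bigr (fun=> e)) => [|t _]; last by rewrite ffunE.
  by rewrite prodr_const card_tuple expn0 expr1.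
apply/idP/eqP => [h|-> /=]; last by rewrite ffunE.
by apply/ffunP => t; rewrite ffunE tuple0.
Qed.

Lemma iid_prob_compl (R : realFieldType) (T : finType) (e : R)
    (E : pred {ffun T -> bool}) :
  iid_prob e (fun x => ~~ E x) = 1 - iid_prob e E.
Proof.
have tot : \sum_(x : {ffun T -> bool}) \prod_t (if x t then e else 1 - e) = 1.
  rewrite -(bigA_distr_bigA (fun (_ : T) (b : bool) => if b then e else 1 - e)).
  by rewrite big1 // => t _; rewrite big_bool /= addrC subrK.
by rewrite -tot (bigID E) /= addrAC subrr add0r.
Qed.

Lemma eq_majority (T : finType) (x y : T -> bool) :
  x =1 y -> majority x = majority y.
Proof.
by move=> h; rewrite /majority; congr (_ < 2 * _)%N; apply: eq_card => t; rewrite !inE h.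
Qed.

Lemma eq_root_state (k n : nat) (x y : n.-tuple 'I_k -> bool) :
  x =1 y -> root_state x = root_state y.
Proof.
elim: n x y => [|n IH] x y h /=; first exact: h.
by apply: eq_majority => i; apply: IH => t; apply: h.
Qed.

Lemma p_hierS (R : realFieldType) (k n : nat) (e : R) :
  p_hier k n.+1 e = p_direct k (p_hier k n e).
Proof.
pose F := {ffun n.-tuple 'I_k -> bool}.
pose join (y : {ffun 'I_k -> F}) : {ffun n.+1.-tuple 'I_k -> bool} :=
  [ffun t => y (thead t) [tuple of behead t]].
pose split (x : {ffun n.+1.-tuple 'I_k -> bool}) : {ffun 'I_k -> F} :=
  [ffun i => [ffun t : n.-tuple 'I_k => x [tuple of i :: t]]].
have joinK : cancel join split.
  move=> y; apply/ffunP => i; apply/ffunP => t; rewrite !ffunE theadE.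
  by congr (y i _); apply: val_inj.
have splitK : cancel split join.
  by move=> x; apply/ffunP => t; rewrite !ffunE -tuple_eta.
rewrite /p_hier {1}/iid_prob (reindex join) /=; last first.
  by apply: onW_bij; exists split.
pose pat (y : {ffun 'I_k -> F}) : {ffun 'I_k -> bool} := [ffun i => root_state (y i)].
rewrite /p_direct {1}/iid_prob.
have patE y : majority (fun i : 'I_k => root_state
    (fun t : n.-tuple 'I_k => join y [tuple of i :: t])) = majority (pat y).
  apply: eq_majority => i; rewrite ffunE; apply: eq_root_state => t.
  by rewrite ffunE theadE; congr (y i _); apply: val_inj.
under eq_bigl do rewrite patE.
rewrite (partition_big pat (fun b => majority b)) //=.
apply: eq_bigr => b hb.
pose w (z : F) := \prod_t (if z t then e else 1 - e).
transitivity (\prod_(i < k) \sum_(z : F | root_state z == b i) w z); last first.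
  apply: eq_bigr => i _; case: (b i).
    by apply: eq_bigl => z; rewrite eqb_id.
  rewrite -iid_prob_compl; apply: eq_bigl => z; by rewrite eqbF_neg.
rewrite bigA_distr_big_dep /=; apply: eq_big => y.
  apply/andP/familyP => [[_ /eqP <-] i|h]; first by rewrite ffunE unfold_in /=.
  have -> : pat y = b by apply/ffunP => i; rewrite ffunE; apply/eqP/h.
  by [].
move=> _; rewrite /w pair_big /=.
rewrite (reindex (fun p : 'I_k * n.-tuple 'I_k => [tuple of p.1 :: p.2])) /=.
  apply: eq_bigr => -[i t] _; rewrite ffunE theadE /=.
  by congr (if y i _ then _ else _); apply: val_inj.
apply: onW_bij; exists (fun t => (thead t, [tuple of behead t])) => [[i t]|t] /=.
  by rewrite theadE; congr pair; apply: val_inj.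
by rewrite -tuple_eta.
Qed.

(* Main.v *)
(** Pair every configuration of votes with its complement.  Both voting rules
    are self-dual: each accepts exactly one configuration out of such a pair.
    If [1/2 < e], the configuration with the more correct votes is the more
    probable one, and the direct majority always accepts that one; hence no
    self-dual rule does better, and a rule that accepts some configuration with
    a minority of correct votes does strictly worse.  For the hierarchy, such a
    configuration puts the correct votes on the paths that use only the first
    [(k + 1) / 2] children: they elect the root with [((k + 1) / 2) ^ n] votes,
    fewer than half of [k ^ n] once [n >= 2].  The range [e < 1/2] follows by
    the symmetry [e <-> 1 - e]. *)
Require Import Defs.
From mathcomp Require Import all_boot all_order all_algebra.
From mathcomp Require Import zify ring lra.
Set Implicit Arguments.
Unset Strict Implicit.
Unset Printing Implicit Defensive.
Import Order.TTheory GRing.Theory Num.Theory.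
Local Open Scope ring_scope.

Definition neg_ffun (T : finType) (x : {ffun T -> bool}) : {ffun T -> bool} :=
  [ffun t => ~~ x t].

Definition selfdual (T : finType) (E : pred {ffun T -> bool}) : Prop :=
  forall x, E (neg_ffun x) = ~~ E x.

Lemma neg_ffunK (T : finType) : involutive (@neg_ffun T).
Proof. by move=> x; apply/ffunP => t; rewrite !ffunE negbK. Qed.

(** An odd number of votes excludes ties, so exactly one of the two complementary sides exceeds
    half. *)
Lemma majority_neg (T : finType) (x : T -> bool) : odd #|T| ->
  majority (fun t => ~~ x t) = ~~ majority x.
Proof.
rewrite /majority => oT.
have hC := cardC [pred t | x t].
have -> : #|[pred t | ~~ x t]| = #|[predC [pred t | x t]]| by apply: eq_card.
by move: oT; rewrite -hC; set m := #|[pred t | x t]|; set p := #|predC _|; lia.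
Qed.

Lemma majority_selfdual (T : finType) : odd #|T| ->
  selfdual (fun x : {ffun T -> bool} => majority x).
Proof.
move=> oT x; rewrite -majority_neg //.
by apply: eq_majority => t; rewrite ffunE.
Qed.

Lemma root_state_neg (k n : nat) (x : n.-tuple 'I_k -> bool) : odd k ->
  root_state (fun t => ~~ x t) = ~~ root_state x.
Proof.
move=> ok; elim: n x => [//|n IH] x /=.
by rewrite -majority_neg ?card_ord //; apply: eq_majority => i; rewrite IH.
Qed.

Lemma root_state_selfdual (k n : nat) : odd k ->
  selfdual (fun x : {ffun n.-tuple 'I_k -> bool} => root_state x).
Proof.
move=> ok x; rewrite -root_state_neg //.
by apply: eq_root_state => t; rewrite ffunE.
Qed.

(** Flipping every vote swaps the factors [e] and [1 - e] in each weight, and self-duality turns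
    accepted configurations into rejected ones. *)
Lemma iid_prob_onem (R : realFieldType) (T : finType) (e : R)
    (E : pred {ffun T -> bool}) : selfdual E ->
  iid_prob (1 - e) E = 1 - iid_prob e E.
Proof.
move=> sdE; rewrite -iid_prob_compl /iid_prob.
rewrite (reindex_inj (inv_inj (@neg_ffunK T))) /=.
apply: eq_big => x; first by rewrite sdE.
move=> _; apply: eq_bigr => t _; rewrite ffunE.
by case: (x t) => //=; ring.
Qed.

Lemma iid_prob0 (R : realFieldType) (T : finType)
    (E : pred {ffun T -> bool}) : ~~ E [ffun=> false] -> iid_prob (0 : R) E = 0.
Proof.
move=> nE; apply: big1 => x Ex.
have [t xt|x0] := pickP [pred t | x t].
  by rewrite (bigD1 t) //= (_ : x t) ?mul0r.
suff xE : x = [ffun=> false] by rewrite xE (negbTE nE) in Ex.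
by apply/ffunP => t; rewrite ffunE; have /= := x0 t.
Qed.

Lemma majority_false (T : finType) : ~~ majority (fun _ : T => false).
Proof. by rewrite /majority (eq_card0 (A := [pred t : T | false])). Qed.

Lemma root_state_false (k n : nat) :
  ~~ root_state (fun _ : n.-tuple 'I_k => false).
Proof.
elim: n => [//|n IH] /=.
by under eq_majority do rewrite (negbTE IH); exact: majority_false.
Qed.

(** With [m] correct votes and [d < m] wrong ones, both weights share the factor
    [(e * (1 - e)) ^+ d]; what remains is [(1 - e) ^+ (m - d) < e ^+ (m - d)]. *)
Lemma iid_weight_neg_lt (R : realFieldType) (T : finType) (e : R)
    (x : {ffun T -> bool}) : 2^-1 < e < 1 -> majority x ->
  \prod_t (if neg_ffun x t then e else 1 - e) <
  \prod_t (if x t then e else 1 - e).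
Proof.
move=> he; rewrite /majority !iid_prob_weight => hx.
have -> : #|[pred t | neg_ffun x t]| = (#|T| - #|[pred t | x t]|)%N.
  rewrite -(cardC [pred t | x t]) addKn; apply: eq_card => t.
  by rewrite !inE ffunE.
have := max_card [pred t | x t]; move: hx.
set m := #|[pred t | x t]|; set N := #|T| => hx hm.
rewrite subKn //; set d := (N - m)%N.
have -> : m = (d + (m - d))%N by rewrite /d; lia.
rewrite !exprD [ltLHS]mulrA [ltRHS]mulrAC ltr_pM2l; last first.
  by rewrite mulr_gt0 // exprn_gt0 //; lra.
by rewrite ltrXn2r; [rewrite /d; lia | lra | lra].
Qed.

Lemma selfdual_lt_majority (R : realFieldType) (T : finType) (e : R)
    (E : pred {ffun T -> bool}) :
  odd #|T| -> selfdual E -> 2^-1 < e < 1 ->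
  (exists2 x : {ffun T -> bool}, E x & ~~ majority x) ->
  iid_prob e E < iid_prob e (fun x : {ffun T -> bool} => majority x).
Proof.
move=> oT sdE he [x0 Ex0 Mx0].
have sdM := majority_selfdual oT.
rewrite /iid_prob (bigID (fun x : {ffun T -> bool} => majority x)) /=.
rewrite [ltRHS](bigID E) /=.
under [X in _ < X + _]eq_bigl do rewrite andbC.
(* Configurations accepted by both rules cancel. Negation maps those accepted by [E] alone
   bijectively onto those accepted by the majority alone, so the sums compare term by term. *)
rewrite ltrD2l (reindex_inj (inv_inj (@neg_ffunK T))) /=.
under eq_bigl do rewrite sdE sdM negbK andbC.
apply: ltr_sum => [|x /andP[Mx _]]; last exact: iid_weight_neg_lt.
(* Strictness needs a nonempty index set: the complement of the given configuration belongs to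
   it. *)
apply/hasP; exists (neg_ffun x0); first exact: mem_index_enum.
by rewrite sdM sdE Mx0 Ex0.
Qed.

(** Transport along [enum_rank] lets the direct vote be taken over the leaves of the tree, so that
    both rules act on the same configurations. *)
Lemma iid_prob_majority (R : realFieldType) (T : finType) (e : R) :
  iid_prob e (fun x : {ffun T -> bool} => majority x) = p_direct #|T| e.
Proof.
rewrite /p_direct /iid_prob.
pose f (y : {ffun 'I_#|T| -> bool}) : {ffun T -> bool} :=
  [ffun t => y (enum_rank t)].
pose g (x : {ffun T -> bool}) : {ffun 'I_#|T| -> bool} :=
  [ffun i => x (enum_val i)].
rewrite (reindex f) /=; last first.
  apply: onW_bij; exists g => z; apply/ffunP => t; rewrite !ffunE.
    by rewrite enum_valK.
  by rewrite enum_rankK.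
apply: eq_big => y.
  rewrite /majority card_ord; congr (_ < 2 * _)%N.
  rewrite -[LHS](card_image (@enum_rank_inj T)); apply: eq_card => i.
  rewrite -[i]enum_valK mem_image; last exact: enum_rank_inj.
  by rewrite !inE ffunE.
move=> _; rewrite [RHS](reindex (@enum_rank T)) /=; last first.
  exact/onW_bij/enum_rank_bij.
by apply: eq_bigr => t _; rewrite ffunE.
Qed.

(** Indices start at 0, so [i <= k./2] keeps [k./2.+1] children: the smallest strict majority when
    [k] is odd. *)
Definition low_paths (k n : nat) : {ffun n.-tuple 'I_k -> bool} :=
  [ffun t : n.-tuple 'I_k => all (fun i : 'I_k => i <= k./2)%N t].

Lemma card_low (k : nat) : odd k ->
  #|[pred i : 'I_k | (i <= k./2)%N]| = k./2.+1.
Proof.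
move=> ok; have le_k : (k./2.+1 <= k)%N by lia.
rewrite -[RHS]card_ord -(card_image (f := widen_ord le_k)); last first.
  by move=> i j /(congr1 val) /= /val_inj.
apply: eq_card => i; rewrite inE; apply/idP/imageP => [hi|[j _ ->]].
  by exists (Ordinal (hi : (i < k./2.+1)%N)) => //; apply: val_inj.
by rewrite /= -ltnS.
Qed.

Lemma root_state_low_paths (k n : nat) : odd k -> root_state (low_paths k n).
Proof.
move=> ok; elim: n => [|n IH] /=; first by rewrite ffunE.
rewrite (_ : majority _ = majority (fun i : 'I_k => (i <= k./2)%N)).
  by rewrite /majority card_ord card_low //; lia.
(* Below a kept child the configuration is [low_paths k n] again; below any other child no vote is
   correct. *)
apply: eq_majority => i; case: leqP => hi.
  rewrite -IH; apply: eq_root_state => t.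
  by rewrite !ffunE /= hi.
apply: negbTE; rewrite (_ : root_state _ = root_state (fun _ : n.-tuple 'I_k => false)).
  exact: root_state_false.
by apply: eq_root_state => t; rewrite !ffunE /= leqNgt hi.
Qed.

(** A path is determined by its choice of child at each of the [n] levels, with [k./2.+1] choices
    per level here. *)
Lemma card_low_paths (k n : nat) : odd k ->
  (#|[pred t | low_paths k n t]| <= k./2.+1 ^ n)%N.
Proof.
move=> ok; pose f (t : n.-tuple 'I_k) := [ffun i => tnth t i].
have f_inj : injective f.
  by move=> t u /ffunP tu; apply: eq_from_tnth => i; have := tu i; rewrite !ffunE.
rewrite -(card_low ok) -[n in (_ ^ n)%N]card_ord -card_ffun_on.
rewrite -(card_image f_inj); apply/subset_leq_card/subsetP => _ /imageP[t ht ->].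
apply/ffun_onP => i; move: ht; rewrite !inE !ffunE => /allP; apply.
exact: mem_tnth.
Qed.

Lemma low_paths_minority (k n : nat) : (3 <= k)%N -> odd k -> (2 <= n)%N ->
  ~~ majority (low_paths k n).
Proof.
move=> hk ok hn; rewrite /majority card_tuple card_ord -leqNgt.
apply: leq_trans (leq_mul (leqnn 2) (card_low_paths n ok)) _.
(* Two levels absorb the factor 2: for [k = 2m + 3] the claim is [2 (m + 2)^2 <= (2m + 3)^2]. The
   other [n - 2] levels only need [k./2.+1 <= k]. *)
rewrite -(subnK hn) !expnD mulnCA leq_mul //; last first.
  have [m ->] : exists m, k = m.*2.+3 by exists (k - 3)./2; lia.
  by rewrite /= uphalf_double -!mul2n; nia.
case: (n - 2)%N => // m; rewrite leq_exp2r //; lia.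
Qed.

Theorem theorem1 (R : realFieldType) (k n : nat)
    (hk : (3 <= k)%N) (hodd : odd k) (hn : (2 <= n)%N) :
  [/\ forall e : R, e = 0 \/ e = 2^-1 \/ e = 1 ->
        p_direct (k ^ n)%N e = p_hier k n e,
      forall e : R, 0 < e < 2^-1 ->
        p_direct (k ^ n)%N e < p_hier k n e
    & forall e : R, 2^-1 < e < 1 ->
        p_hier k n e < p_direct (k ^ n)%N e].
Proof.
have cardT : #|{: n.-tuple 'I_k}| = (k ^ n)%N by rewrite card_tuple card_ord.
have oT : odd #|{: n.-tuple 'I_k}| by rewrite cardT oddX hodd orbT.
have dE (e : R) := iid_prob_majority (n.-tuple 'I_k) e.
rewrite cardT in dE.
have sdH := @root_state_selfdual k n hodd.
have sdD := majority_selfdual oT.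
have hierN (e : R) : p_hier k n (1 - e) = 1 - p_hier k n e.
  exact: iid_prob_onem.
have dirN (e : R) : p_direct (k ^ n) (1 - e) = 1 - p_direct (k ^ n) e.
  by rewrite -!dE; apply: iid_prob_onem.
have gt_half (e : R) : 2^-1 < e < 1 -> p_hier k n e < p_direct (k ^ n) e.
  move=> he; rewrite -dE; apply: selfdual_lt_majority => //.
  by exists (low_paths k n); [apply: root_state_low_paths|apply: low_paths_minority].
have hier0 : p_hier k n (0 : R) = 0.
  apply: iid_prob0; rewrite (_ : root_state _ = root_state (fun _ : n.-tuple 'I_k => false)).
    exact: root_state_false.
  by apply: eq_root_state => t; rewrite ffunE.
have dir0 : p_direct (k ^ n) (0 : R) = 0.
  apply: iid_prob0; rewrite (_ : majority _ = majority (fun _ : 'I_(k ^ n) => false)).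
    exact: majority_false.
  by apply: eq_majority => t; rewrite ffunE.
split=> // [e|e he].
  case=> [->|[->|->]]; first by rewrite hier0 dir0.
    (* The symmetry fixes [2^-1], so each probability equals its own complement there, hence
       [2^-1]. *)
    have half : 1 - 2^-1 = 2^-1 :> R by lra.
    by have := hierN 2^-1; have := dirN 2^-1; rewrite half; lra.
  by have := hierN 0; have := dirN 0; rewrite subr0 hier0 dir0; lra.
have: 2^-1 < 1 - e < 1 by lra.
by move/gt_half; rewrite hierN dirN; lra.
Qed.
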